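(* (i) $(\mathcal{N},=,\sim_V)\models\forall\mathsf{x}\forall\mathsf{y}[\mathsf{x}\sim\mathsf{y}\rightarrow(\mathsf{x}=\mathsf{y}\vee\neg(\mathsf{x}=\mathsf{y}))]$, i.e. $\forall\alpha\forall\beta[\alpha\sim_V\beta\rightarrow(\alpha=\beta\vee\neg(\alpha=\beta))]$. (ii) $(\mathcal{N},=,\sim^\omega_V)\models\forall\mathsf{x}\,\neg\forall\mathsf{y}[\mathsf{x}\sim\mathsf{y}\rightarrow(\mathsf{x}=\mathsf{y}\vee\neg(\mathsf{x}=\mathsf{y}))]$, i.e. for every $\gamma$ it is not the case that $\forall\alpha[\gamma\sim^\omega_V\alpha\rightarrow(\gamma=\alpha\vee\neg(\gamma=\alpha))]$.
   Context: Intuitionistic mathematics (constructive reading of logical constants; Markov's Principle not assumed), with Brouwer's Continuity Principle as an axiom (for every $R\subseteq\mathcal{N}\times\omega$, if $\forall\alpha\exists n[\alpha Rn]$ then $\forall\alpha\exists m\exists n\forall\beta[\overline{\alpha}m\sqsubset\beta\rightarrow\beta Rn]$, where $\overline{\alpha}m=\langle\alpha(0),\dots,\alpha(m-1)\rangle$ and $\sqsubset$ is ''initial segment of''). $\mathcal{N}=\omega^\omega$, $=$ is equality of sequences. The first-order language has binary relation symbols $=$ (interpreted as equality) and $\sim$ (interpreted by the third component of the structure). $\alpha\sim^0_V\beta$ (also written $\alpha\sim_V\beta$) iff $\exists n\forall m>n[\alpha(m)=\beta(m)]$; $\alpha\sim^{i+1}_V\beta$ iff $\exists n\forall m>n[\alpha(m)\neq\beta(m)\rightarrow\alpha\sim^i_V\beta]$;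 $\alpha\sim^\omega_V\beta$ iff $\exists i[\alpha\sim^i_V\beta]$. *)

(* Defs.v *)
From Stdlib Require Import Arith.

Definition Baire := nat -> nat.

Definition seq_eq (a b : Baire) : Prop := forall n, a n = b n.

Definition agree_upto (a : Baire) (m : nat) (b : Baire) : Prop :=
  forall k, k < m -> a k = b k.

Fixpoint simV (i : nat) (a b : Baire) : Prop :=
  match i with
  | 0 => exists n, forall m, n < m -> a m = b m
  | S j => exists n, forall m, n < m -> a m <> b m -> simV j a b
  end.

Definition simV_omega (a b : Baire) : Prop := exists i, simV i a b.

Definition BCP : Prop :=
  forall R : Baire -> nat -> Prop,
    (forall a, exists n, R a n) ->
    forall a, exists m, exists n, forall b, agree_upto a m b -> R b n.

(* Main.v *)
(* (i) If a and b agree beyond n, then a = b reduces to the decidable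
   agreement of their first n+1 values.
   (ii) Perturb g by one at the first place where a sequence a is nonzero.
   The result is ~^1_V-related to g, since it differs from g at most once, and it
   equals g exactly when a is the zero sequence. Deciding equality with g for
   every ~^omega_V-neighbour would therefore decide "a is zero" for every a.
   By Brouwer's Continuity Principle that property would then be determined by
   a finite initial segment of a, and no initial segment of the zero sequence
   determines it. *)
Require Import Defs.
From Stdlib Require Import Arith Lia Bool.

Lemma agree_upto_dec (a b : Baire) (m : nat) :
  agree_upto a m b \/ ~ agree_upto a m b.
Proof.
  induction m as [|m [IH|IH]].
  - left; intros k Hk; lia.
  - destruct (Nat.eq_dec (a m) (b m)) as [E|E].
    + left; intros k Hk.
      destruct (Nat.eq_dec k m) as [->|]; [exact E | apply IH; lia].
    + right; intro H; apply E, H; lia.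
  - right; intro H; apply IH; intros k Hk; apply H; lia.
Qed.

Lemma seq_eq_dec_of_eventually_eq (a b : Baire) (n : nat) :
  (forall m, n < m -> a m = b m) -> seq_eq a b \/ ~ seq_eq a b.
Proof.
  intros Hn.
  destruct (agree_upto_dec a b (S n)) as [H|H].
  - left; intro k.
    destruct (le_lt_dec k n); [apply H; lia | apply Hn; lia].
  - right; intro E; apply H; intros k _; apply E.
Qed.

Lemma BCP_decidable_locally_constant (P : Baire -> Prop) :
  BCP -> (forall a, P a \/ ~ P a) ->
  forall a, exists m, forall b, agree_upto a m b -> (P b <-> P a).
Proof.
  intros bcp Pdec a.
  set (R := fun b n => match n with 0 => P b | _ => ~ P b end).
  assert (Rtotal : forall b, exists n, R b n).
  { intro b; destruct (Pdec b); [exists 0 | exists 1]; assumption. }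
  destruct (bcp R Rtotal a) as [m [n Hn]].
  exists m; intros b Hb.
  assert (Ra : R a n) by (apply Hn; intros k _; reflexivity).
  specialize (Hn b Hb).
  destruct n; simpl in Ra, Hn; tauto.
Qed.

Fixpoint all_zero_below (a : Baire) (m : nat) : bool :=
  match m with
  | 0 => true
  | S k => all_zero_below a k && (a k =? 0)
  end.

Lemma all_zero_below_spec (a : Baire) (m : nat) :
  all_zero_below a m = true <-> (forall k, k < m -> a k = 0).
Proof.
  induction m as [|m IH]; simpl.
  - split; [intros _ k Hk; lia | reflexivity].
  - rewrite andb_true_iff, IH, Nat.eqb_eq.
    split.
    + intros [H Hm] k Hk.
      destruct (Nat.eq_dec k m) as [->|]; [exact Hm | apply H; lia].
    + intros H; split; [intros k Hk; apply H | apply H]; lia.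
Qed.

Definition first_nonzero (a : Baire) (m : nat) : bool :=
  all_zero_below a m && negb (a m =? 0).

Lemma first_nonzero_later (a : Baire) (m m' : nat) :
  first_nonzero a m = true -> m < m' -> first_nonzero a m' = false.
Proof.
  unfold first_nonzero; intros Hm Hlt.
  apply andb_true_iff in Hm as [_ Hm].
  apply negb_true_iff, Nat.eqb_neq in Hm.
  destruct (all_zero_below a m') eqn:E; [|reflexivity].
  exfalso; apply Hm, (proj1 (all_zero_below_spec a m') E); exact Hlt.
Qed.

Definition bump_first_nonzero (g a : Baire) : Baire :=
  fun m => if first_nonzero a m then S (g m) else g m.

Lemma bump_first_nonzero_simV1 (g a : Baire) :
  simV 1 g (bump_first_nonzero g a).
Proof.
  exists 0; intros m _ Hne.
  exists m; intros m' Hm'.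
  unfold bump_first_nonzero.
  destruct (first_nonzero a m) eqn:E.
  - rewrite (first_nonzero_later a m m' E Hm'); reflexivity.
  - exfalso; apply Hne; unfold bump_first_nonzero; rewrite E; reflexivity.
Qed.

Lemma bump_first_nonzero_zero (g : Baire) :
  seq_eq g (bump_first_nonzero g (fun _ => 0)).
Proof.
  intro m; unfold bump_first_nonzero, first_nonzero.
  rewrite andb_false_r; reflexivity.
Qed.

Definition point_mass (m : nat) : Baire := fun k => if k =? m then 1 else 0.

Lemma point_mass_agree_zero (m : nat) : agree_upto (fun _ => 0) m (point_mass m).
Proof.
  intros k Hk; unfold point_mass.
  destruct (Nat.eqb_spec k m); [lia | reflexivity].
Qed.

Lemma first_nonzero_point_mass (m : nat) : first_nonzero (point_mass m) m = true.
Proof.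
  unfold first_nonzero.
  rewrite (proj2 (all_zero_below_spec _ _)).
  - unfold point_mass; rewrite Nat.eqb_refl; reflexivity.
  - intros k Hk; symmetry; exact (point_mass_agree_zero m k Hk).
Qed.

Theorem theorem12p1 :
  BCP ->
  (forall a b : Baire, simV 0 a b -> (seq_eq a b \/ ~ seq_eq a b)) /\
  (forall g : Baire,
     ~ (forall a : Baire, simV_omega g a -> (seq_eq g a \/ ~ seq_eq g a))).
Proof.
  intros bcp; split.
  - intros a b [n Hn]; exact (seq_eq_dec_of_eventually_eq a b n Hn).
  - intros g Hdec.
    set (P := fun a => seq_eq g (bump_first_nonzero g a)).
    assert (Pdec : forall a, P a \/ ~ P a).
    { intro a; apply Hdec; exists 1; apply bump_first_nonzero_simV1. }
    destruct (BCP_decidable_locally_constant P bcp Pdec (fun _ => 0)) as [m Hm].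
    assert (Hpm : P (point_mass m)).
    { apply (Hm _ (point_mass_agree_zero m)), bump_first_nonzero_zero. }
    specialize (Hpm m); unfold bump_first_nonzero in Hpm.
    rewrite first_nonzero_point_mass in Hpm; lia.
Qed.
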